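(* Let $X$ be a metric space. Then the map $\dim_{ML}\colon\mathcal{K}(X)\to[0,\infty]$, $K\mapsto\dim_{ML}K$, is Borel measurable. More precisely, it is of Baire class $2$.
   Context: Subsets of a metric space are regarded as metric spaces with the inherited metric. For a metric space $(X,\rho)$, $B(x,r)=\{y\in X:\rho(x,y)\le r\}$ denotes the closed ball in $X$, and $N_r(A)\in\{0,1,2,\dots\}\cup\{\infty\}$ denotes the minimal number of sets of diameter at most $r$ required to cover $A\subset X$. The lower dimension of a metric space $X$ with at least two points is $$\dim_L X=\sup\Big\{\alpha\in\mathbb{R}:\ \exists\, C>0 \text{ such that for all real } 0<r<R\le\operatorname{diam}X \text{ and all } x\in X,\ N_r(B(x,R))\ge C\left(\tfrac{R}{r}\right)^{\alpha}\Big\}\in[0,\infty],$$ where $\operatorname{diam}X$ may be $\infty$. Conventions: $\dim_L\emptyset=0$, and $\dim_L X=0$ if $X$ is a one-point space. The modified lower dimension of a metric space $X$ is $\dim_{ML}X=\sup\{\dim_L E: E\subset X\}$. $\mathcal{K}(X)$ is the set of non-empty compact subsets of $X$ endowed with the Hausdorff metric $$d_H(K_1,K_2)=\min\{r: K_1\subset B(K_2,r)\text{ and }K_2\subset B(K_1,r)\},$$ where $B(A,r)=\{x\in X:\exists y\in A\text{ such that }\rho(x,y)\le r\}$. A subset of a metric space is $G_\delta$ if it is a countable intersection of open sets, and $G_{\delta\sigma}$ if it is a countable union of $G_\delta$ sets. For a metric space $Y$, a function $f\colon Y\to[0,\infty]$ is of Baire class $2$ if the sets $\{y\in Y:f(y)>\alpha\}$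 and $\{y\in Y:f(y)<\alpha\}$ are $G_{\delta\sigma}$ for all real $\alpha\ge 0$. *)

(* Defs.v *)
From HB Require Import structures.
From mathcomp Require Import all_boot all_order all_algebra.
From mathcomp Require Import all_classical all_reals all_analysis.
From mathcomp Require Import measurable_realfun borel_hierarchy.

Set Implicit Arguments.
Unset Strict Implicit.
Unset Printing Implicit Defensive.

Import Order.TTheory GRing.Theory Num.Theory.
Import numFieldNormedType.Exports.

Local Open Scope classical_set_scope.
Local Open Scope ring_scope.

(* A set [A] in a metric space [T] stands for the metric space [A] with the
   inherited metric: points range over [A] and the closed ball of [A] of centre
   [x] is [A `&` cball x r].  A metric space [T] itself is [[set: T]]. *)

Section metric_dimensions.
Context {R : realType} {T : metricType R}.
Implicit Types (A E : set T) (x y : T) (r : R).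

Definition cball x r : set T := [set y | mdist x y <= r].

(* The element 0 only serves to give the empty set diameter 0. *)
Definition diam A : \bar R :=
  ereal_sup (0%E |` [set (mdist p.1 p.2)%:E | p in A `*` A]).

(* [+oo] when there is no finite cover, since [ereal_inf set0 = +oo]. *)
Definition covering_number r A : \bar R :=
  ereal_inf [set n%:R%:E | n in [set n : nat | exists F : 'I_n -> set T,
    (forall i, (diam (F i) <= r%:E)%E) /\ A `<=` \bigcup_i F i]].

Definition lower_exponent A (alpha : R) : Prop :=
  exists2 C : R, 0 < C & forall r r' : R, 0 < r -> r < r' ->
    (r'%:E <= diam A)%E -> forall x, A x ->
    ((C * (r' / r) `^ alpha)%:E <= covering_number r (A `&` cball x r'))%E.

Definition lower_dim A : \bar R :=
  if `[< is_subset1 A >] then 0%E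
  else ereal_sup [set alpha%:E | alpha in lower_exponent A].

Definition mod_lower_dim A : \bar R :=
  ereal_sup [set lower_dim E | E in [set E | E `<=` A]].

Definition thickening A r : set T := [set x | exists2 y, A y & mdist x y <= r].

End metric_dimensions.

Section hyperspace_def.
Context {R : realType}.

Record hyperspace (T : metricType R) := Hyperspace {
  hyperspace_set :> set T;
  hyperspace_neq0 : hyperspace_set !=set0;
  hyperspace_compact : compact hyperspace_set }.

Definition hausdorff_radii {T : metricType R} (K L : set T) : set R :=
  [set r | K `<=` thickening L r /\ L `<=` thickening K r].

(* The infimum is a minimum: see [hausdorff_dist_min]. *)
Definition hausdorff_dist {T : metricType R} (K L : set T) : R :=
  inf (hausdorff_radii K L).

End hyperspace_def.

Section hyperspace_metric.
Context {R : realType} {T : metricType R}.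
Implicit Types (K L M : hyperspace T) (r : R).

Lemma hyperspace_inj K L : K = L :> set T -> K = L.
Proof.
case: K L => [K K0 cK] [L L0 cL] /= KL; case: _ / KL in L0 cL *.
by rewrite (Prop_irrelevance K0 L0) (Prop_irrelevance cK cL).
Qed.

Lemma mdist_continuous (x : T) : continuous (mdist x : T -> R).
Proof.
move=> y; apply/cvgrPdist_lt => e e0.
near=> z.
have yz : mdist y z < e.
  by near: z; have := nbhsx_ballx y e e0; rewrite ballEmdist.
have := metric_triangle x y z; have := metric_triangle x z y.
rewrite (metric_sym z y) => h1 h2; rewrite ltr_norml; apply/andP; split.
- by rewrite ltrBrDl -ltrBrDr opprK; apply: le_lt_trans h2 _; rewrite ltrD2l.
- by rewrite ltrBlDl; apply: le_lt_trans h1 _; rewrite ltrD2l.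
Unshelve. all: by end_near. Qed.

Lemma hausdorff_radii_ge0 K L r : hausdorff_radii K L r -> 0 <= r.
Proof.
have [x Kx] := hyperspace_neq0 K; move=> [/(_ x Kx)[y _ xy] _].
exact: le_trans (mdist_ge0 _ _) xy.
Qed.

Lemma hausdorff_radii_has_inf K L : has_inf (hausdorff_radii K L).
Proof.
split; last by exists 0 => r /hausdorff_radii_ge0.
have [[x Kx] [y Ly]] := (hyperspace_neq0 K, hyperspace_neq0 L).
have max_dist (A : set T) z : A !=set0 -> compact A ->
    exists c, forall t, A t -> mdist z t <= mdist z c.
  move=> A0 cA; have [|c _ h] := @compact_EVT_max _ _ (mdist z) A A0 cA.
    exact/continuous_subspaceT/mdist_continuous.
  by exists c => t At; apply: h; rewrite inE.
have [c hc] := max_dist _ y (hyperspace_neq0 K) (@hyperspace_compact _ _ K).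
have [d hd] := max_dist _ x (hyperspace_neq0 L) (@hyperspace_compact _ _ L).
exists (Num.max (mdist y c) (mdist x d)); split => [z /hc zc|z /hd zd].
- by exists y => //; rewrite metric_sym le_max zc.
- by exists x => //; rewrite metric_sym le_max zd orbT.
Qed.

Lemma thickeningS (A : set T) (x : T) r s :
  r <= s -> thickening A r x -> thickening A s x.
Proof. by move=> rs [y Ay xy]; exists y => //; exact: le_trans xy rs. Qed.

Lemma thickening_closed L (x : T) r :
  (forall s, r < s -> thickening L s x) -> thickening L r x.
Proof.
have [|c] := @compact_EVT_min _ _ (mdist x) L (hyperspace_neq0 L)
  (@hyperspace_compact _ _ L).
  exact/continuous_subspaceT/mdist_continuous.
rewrite inE => Lc minc h; exists c => //.
apply/ler_addgt0Pr => e e0; have [|y Ly xy] := h (r + e).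
  by rewrite ltrDl.
by rewrite (le_trans _ xy)// minc// inE.
Qed.

Lemma hausdorff_dist_min K L : hausdorff_radii K L (hausdorff_dist K L).
Proof.
have hinf s : hausdorff_dist K L < s -> hausdorff_radii K L s.
  rewrite -subr_gt0 => /inf_adherent/(_ (hausdorff_radii_has_inf K L))[r].
  rewrite addrC subrK => -[KL LK] rs.
  by split=> x; [move=> /KL|move=> /LK]; apply/thickeningS/ltW.
by split=> x xKL; apply: thickening_closed => s /hinf[KL LK]; auto.
Qed.

Lemma hausdorff_dist_le K L r : hausdorff_radii K L r -> hausdorff_dist K L <= r.
Proof. by apply: ge_inf; have [] := hausdorff_radii_has_inf K L. Qed.

Lemma hausdorff_distxx K : hausdorff_dist K K = 0.
Proof.
apply/eqP; rewrite eq_le (hausdorff_radii_ge0 (hausdorff_dist_min K K)) andbT.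
by apply: hausdorff_dist_le; split=> x Kx; exists x => //; rewrite mdistxx.
Qed.

Lemma hausdorff_dist_eq0 K L : hausdorff_dist K L = 0 -> K = L.
Proof.
move=> KL0; have := hausdorff_dist_min K L; rewrite KL0 => -[KL LK].
have mdist_le0 (x y : T) : mdist x y <= 0 -> x = y.
  move=> xy; apply: mdist_positivity; apply/eqP.
  by rewrite eq_le xy mdist_ge0.
apply: hyperspace_inj; apply/seteqP; split=> x.
- by move=> /KL[y Ly /mdist_le0 ->].
- by move=> /LK[y Ky /mdist_le0 ->].
Qed.

Lemma hausdorff_dist_sym K L : hausdorff_dist K L = hausdorff_dist L K.
Proof.
have [KL LK] := hausdorff_dist_min K L; have [LK' KL'] := hausdorff_dist_min L K.
by apply/eqP; rewrite eq_le; apply/andP; split; apply: hausdorff_dist_le.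
Qed.

Lemma hausdorff_dist_triangle L K M :
  hausdorff_dist K M <= hausdorff_dist K L + hausdorff_dist L M.
Proof.
have [KL LK] := hausdorff_dist_min K L; have [LM ML] := hausdorff_dist_min L M.
apply: hausdorff_dist_le; split=> x.
- move=> /KL[y /LM[z Mz yz] xy]; exists z => //.
  by rewrite (le_trans (metric_triangle x y z))// lerD.
- move=> /ML[y /LK[z Kz yz] xy]; exists z => //.
  by rewrite (le_trans (metric_triangle x y z))// addrC lerD.
Qed.

HB.instance Definition _ := gen_eqMixin (hyperspace T).
HB.instance Definition _ := gen_choiceMixin (hyperspace T).
HB.instance Definition _ := @isMetric.Build R (hyperspace T)
  hausdorff_dist hausdorff_distxx hausdorff_dist_eq0 hausdorff_dist_sym
  hausdorff_dist_triangle.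

End hyperspace_metric.

Section borel.
Context {Y : topologicalType}.

Definition Gdelta_sigma (S : set Y) : Prop :=
  exists2 F : (set Y)^nat, (forall i, Gdelta (F i)) & S = \bigcup_i F i.

(* Not stated with [measurable_fun] on [g_sigma_algebraType], which would
   require [Y] to be pointed. *)
Definition borel_measurable {R : realType} (f : Y -> \bar R) : Prop :=
  forall B : set (\bar R), measurable B -> <<s (@open Y) >> (f @^-1` B).

Definition baire_class2 {R : realType} (f : Y -> \bar R) : Prop :=
  forall alpha : R, 0 <= alpha ->
    Gdelta_sigma [set y | (alpha%:E < f y)%E] /\
    Gdelta_sigma [set y | (f y < alpha%:E)%E].

End borel.

(* Main.v *)
(* For a >= 0, dim_ML K > a iff K contains a set E such that, for some e > 0,
   E has two points at distance >= e and every ball of E of radius r' <= e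
   contains at least e (r'/r)^(a+e) points which are r/2-separated; one may take
   e = 1/(n+1).  For fixed e the set of such K is closed: if an ultrafilter
   converges to K and every L in one of its members contains such an E_L, the
   limits of the selections of the E_L form such a set E in K, since every
   selection of points of L converges to a point of the compact set K.  Hence
   {dim_ML > a} is F_sigma, which for a nonnegative function implies both Baire
   class 2 and Borel measurability. *)
Require Import Defs.
From mathcomp Require Import all_boot all_order all_algebra.
From mathcomp Require Import all_classical all_reals all_analysis.
From mathcomp Require Import borel_hierarchy measurable_realfun ring lra.
Import Order.TTheory GRing.Theory Num.Theory.
Import numFieldNormedType.Exports.

Section separation.
Set Implicit Arguments.
Unset Strict Implicit.
Unset Printing Implicit Defensive.
Local Open Scope classical_set_scope.
Local Open Scope ring_scope.
Context {R : realType} {T : metricType R}.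
Implicit Types (A E : set T) (x y : T) (r s e b : R) (n : nat).

(** * Separated families and covering numbers *)

Definition has_separated n s A := exists p : 'I_n -> T,
  (forall i, A (p i)) /\ (forall i j, i != j -> s <= mdist (p i) (p j)).

Lemma mdist_le_diam A x y : A x -> A y -> ((mdist x y)%:E <= diam A)%E.
Proof. by move=> Ax Ay; apply: ereal_sup_ubound; right; exists (x, y). Qed.

Lemma diam_cball x s : 0 <= s -> (diam (cball x s) <= (s * 2)%:E)%E.
Proof.
move=> s0; apply: ge_ereal_sup => _ [->|[[y z] [/= xy xz] <-]].
  by rewrite lee_fin mulr_ge0.
rewrite lee_fin (le_trans (metric_triangle y x z))// metric_sym.
by rewrite mulr_natr mulr2n lerD.
Qed.

(** The points of a separated family that cannot be enlarged are centres of closed balls of radius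
    [s] covering [A]. *)
Lemma covering_number_le_separated n s A : 0 <= s ->
  ~ has_separated n.+1 s A -> (covering_number (s * 2) A <= n%:R%:E)%E.
Proof.
move=> s0; elim: n => [|n IHn] nsep.
- apply: ereal_inf_lbound; exists 0%N => //.
  exists (fun=> set0); split=> [[]//|x Ax]; exfalso; apply: nsep.
  by exists (fun=> x); split=> // i j; rewrite !ord1 eqxx.
- have [[p [Ap sp]]|/IHn h] := pselect (has_separated n.+1 s A); last first.
    by rewrite (le_trans h)// lee_fin ler_nat.
  apply: ereal_inf_lbound; exists n.+1 => //.
  exists (fun i => cball (p i) s); split=> [i|x Ax]; first exact: diam_cball.
  apply: contrapT => ncov; apply: nsep.
  have far i : s <= mdist (p i) x.
    by rewrite leNgt; apply/negP => pix; apply: ncov; exists i => //; exact: ltW.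
  (* The uncovered point [x] takes the last index, [p] the others. *)
  exists (fun i => if unlift ord_max i is Some j then p j else x).
  split=> [i|i j]; first by case: unliftP.
  case: unliftP => [i' ->|->]; case: unliftP => [j' ->|->].
  + by move=> ij; apply: sp; apply: contra_neq ij => ->.
  + by [].
  + by rewrite metric_sym.
  + by rewrite eqxx.
Qed.

(** Pigeonhole: as [r < s], a set of diameter at most [r] contains at most one point of the
    family. *)
Lemma separated_le_covering_number n s r A : r < s ->
  has_separated n s A -> (n%:R%:E <= covering_number r A)%E.
Proof.
move=> rs [p [Ap sp]]; apply: le_ereal_inf_tmp => _ [m [F [dF cF]] <-].
rewrite lee_fin ler_nat leqNgt; apply/negP => mn.
have /choice[f pf] i : exists k, F k (p i) by have [k _] := cF _ (Ap i); exists k.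
have : ~ injective f.
  by move=> /leq_card; rewrite !card_ord leqNgt mn.
apply=> i j fij; apply/eqP/contraT => /sp /(lt_le_trans rs).
rewrite ltNge -lee_fin (le_trans _ (dF (f i)))//.
by apply: mdist_le_diam; rewrite // fij.
Qed.

Lemma has_separatedS n s A B : A `<=` B -> has_separated n s A ->
  has_separated n s B.
Proof. by move=> AB [p [Ap sp]]; exists p; split=> // i; apply: AB. Qed.

(* Separated points of closed balls are used instead of covers because such
   families of points survive limits, while covering numbers only do so up to a
   change of scale; the factor 1/2 comes from [covering_number_le_separated].
   One parameter [e] serves as scale bound, diameter bound and constant. *)
Definition abundant e b E :=
  (exists x y, [/\ E x, E y & e <= mdist x y]) /\
  forall x r r' n, E x -> 0 < r -> r < r' -> r' <= e ->
    n%:R < e * (r' / r) `^ b -> has_separated n.+1 (r / 2) (E `&` cball x r').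

(** * Abundance and lower exponents *)

(** The gap [b' - b] pays for raising the exponent to [b + e']. All small [e'] are allowed, so that
    1/(n+1) can be chosen later. *)
Lemma lower_exponent_abundant E b b' : lower_exponent E b' -> b < b' ->
  ~ is_subset1 E -> exists2 e, 0 < e & forall e', e' <= e -> abundant e' (b + e') E.
Proof.
move=> [C C0 hC] bb' E1.
have [x [y [Ex Ey xy]]] : exists x y, [/\ E x, E y & x != y].
  apply: contrapT => h; apply: E1 => x y Ex Ey.
  by apply/eqP/contraT => xy; exfalso; apply: h; exists x, y.
exists (Num.min C (Num.min (b' - b) (mdist x y))).
  by rewrite !lt_min C0 subr_gt0 bb' mdist_gt0.
move=> e; rewrite !le_min => /and3P[eC eb exy].
have eb' : b + e <= b' by lra.
split; first by exists x, y.
move=> z r r' n Ez r0 rr' r'e ltn; apply: contrapT => /covering_number_le_separated.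
rewrite divfK ?pnatr_eq0// => /(_ (divr_ge0 (ltW r0) (ler0n _ 2))).
have r'd : (r'%:E <= diam E)%E.
  by rewrite (le_trans _ (mdist_le_diam Ex Ey))// lee_fin (le_trans r'e).
apply/negP; rewrite -ltNge; apply: lt_le_trans (hC r r' r0 rr' r'd z Ez).
rewrite lte_fin (lt_le_trans ltn)// ler_pM ?powR_ge0//.
  by rewrite (le_trans (ltW r0))// (le_trans (ltW rr')).
by rewrite ler_powR// ler_pdivlMr// mul1r ltW.
Qed.

(** Abundance only concerns radii up to [e]. The bound [D] allows a larger [r'] to be cut down to
    [r1], at the cost of a factor [D / e]. *)
Lemma abundant_lower_exponent E e b D : 0 < e -> 0 <= b ->
  (forall x y, E x -> E y -> mdist x y <= D) -> abundant e b E ->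
  lower_exponent E b.
Proof.
move=> e0 b0 ED [[x0 [y0 [Ex0 Ey0 exy]]] abE].
have eD : e <= D by rewrite (le_trans exy)// ED.
have D0 : 0 < D by exact: lt_le_trans eD.
(* The factor 3 comes from using abundance at scale [3 * r]: the separation [3 * r / 2] must exceed
   [r]. *)
pose M := 3 * (D / e).
have M0 : 0 < M by rewrite mulr_gt0// divr_gt0.
have c0 : 0 < Num.min 1 e by rewrite lt_min ltr01.
exists (Num.min 1 e * M^-1 `^ b); first by rewrite mulr_gt0// powR_gt0// invr_gt0.
move=> r r' r0 rr' r'diam x Ex.
have r'0 := lt_trans r0 rr'.
have r'D : r' <= D.
  rewrite -lee_fin (le_trans r'diam)//; apply: ge_ereal_sup => d [->|].
    by rewrite lee_fin ltW.
  by move=> [[y z] [/= Ey Ez] <-]; rewrite lee_fin ED.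
rewrite -mulrA -powRM ?invr_ge0 ?divr_ge0 ?(ltW M0) ?(ltW r0) ?(ltW r'0)//.
set t := M^-1 * _; pose r1 := Num.min r' e.
have t0 : 0 <= t by rewrite mulr_ge0 ?invr_ge0 ?divr_ge0// ltW.
have r10 : 0 < r1 by rewrite lt_min r'0.
have r'r1 : r' <= D / e * r1.
  rewrite /r1; case: (leP r' e) => r'e; last by rewrite divfK// gt_eqF.
  by rewrite ler_peMl ?(ltW r'0)// ler_pdivlMr// mul1r.
have tr1 : t <= r1 / (3 * r).
  have -> : r1 / (3 * r) = M^-1 * (D / e * r1 / r).
    by rewrite /M; field; rewrite ?gt_eqF.
  by rewrite ler_pM2l ?invr_gt0// ler_pM2r ?invr_gt0.
(* If [r1 <= 3 * r], then [t <= 1] and a single point suffices. *)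
have [r31|r31] := ltP (3 * r) r1.
- apply: le_ereal_inf_tmp => _ [n hn <-]; rewrite lee_fin leNgt; apply/negP => nt.
  have covn : (covering_number r (E `&` cball x r') <= n%:R%:E)%E.
    by apply: ereal_inf_lbound; exists n.
  have [||||] := abE x (3 * r) r1 n Ex => //.
  + by rewrite mulr_gt0.
  + by rewrite ge_min lexx orbT.
  + rewrite (lt_le_trans nt)// ler_pM ?powR_ge0 ?(ltW c0)// ?ge_min ?lexx ?orbT//.
    by rewrite ge0_ler_powR// nnegrE// (le_trans t0).
  + move=> p hp; have : has_separated n.+1 (3 * r / 2) (E `&` cball x r').
      apply: has_separatedS (ex_intro _ p hp) => z [Ez xz]; split=> //.
      by rewrite /cball/= (le_trans xz)// ge_min lexx.
    move=> /(@separated_le_covering_number _ _ r)-/(_ _)/le_trans-/(_ _ _ covn).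
    by rewrite lee_fin ler_nat ltnn => H; apply: notF; apply: H; lra.
- apply: (@le_trans _ _ 1%:E).
    rewrite lee_fin -[leRHS]mulr1 ler_pM ?powR_ge0 ?(ltW c0)// ?ge_min ?lexx//.
    rewrite -[leRHS](congr1 (@^~ b) (@powR1 R)) ge0_ler_powR//
      ?nnegrE// (le_trans tr1)//.
    by rewrite ler_pdivrMr ?mul1r// mulr_gt0.
  apply: (@separated_le_covering_number 1 (r + 1)); first by rewrite ltrDl.
  exists (fun=> x); split=> [_|i j]; last by rewrite !ord1 eqxx.
  by split=> //; rewrite /cball/= mdistxx ltW.
Qed.


Lemma compact_mdist_bounded A : compact A ->
  exists D, forall x y, A x -> A y -> mdist x y <= D.
Proof.
have [->|/set0P[z Az]] := eqVneq A set0; first by exists 0.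
move=> cA; have [||c _ hc] := @compact_EVT_max _ _ (mdist z) A _ cA.
- by exists z.
- exact/continuous_subspaceT/mdist_continuous.
- exists (mdist z c * 2) => x y Ax Ay.
  rewrite (le_trans (metric_triangle x z y))// mulr_natr mulr2n metric_sym.
  by rewrite lerD// hc// inE.
Qed.

(** Compactness supplies the bound on distances that turns abundance into a lower exponent;
    [0 <= alpha] rules out sets with at most one point. *)
Lemma mod_lower_dim_gt A alpha : compact A -> 0 <= alpha ->
  (alpha%:E < mod_lower_dim A)%E <-> exists n E,
    E `<=` A /\ abundant n.+1%:R^-1 (alpha + n.+1%:R^-1) E.
Proof.
move=> cA alpha0; split.
- move=> /ereal_sup_gtP[_ [E EA <-]]; rewrite /lower_dim; case: asboolP => E1.
    by rewrite lte_fin ltNge alpha0.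
  move=> /ereal_sup_gtP[_ [b expb <-]]; rewrite lte_fin => ab.
  have [e e0 he] := lower_exponent_abundant expb ab E1.
  (* This index makes [n.+1%:R^-1] at most [e]. *)
  exists (Num.truncn e^-1), E; split=> //; apply: he.
  by rewrite -[leRHS]invrK lef_pV2 ?posrE ?invr_gt0// ltW// truncnS_gt.
- move=> [n [E [EA abE]]]; have n0 : 0 < n.+1%:R^-1 :> R by rewrite invr_gt0.
  have [D AD] := compact_mdist_bounded cA.
  apply/ereal_sup_gtP; exists (lower_dim E); first by exists E.
  rewrite /lower_dim asboolF; last first.
    move=> E1; have [[x [y [Ex Ey +]]] _] := abE.
    by rewrite (E1 _ _ Ex Ey) mdistxx leNgt n0.
  apply/ereal_sup_gtP; exists (alpha + n.+1%:R^-1)%:E.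
    exists (alpha + n.+1%:R^-1) => //.
    apply: (abundant_lower_exponent (D := D) n0) => //.
      by rewrite addr_ge0// ltW.
    by move=> x y Ex Ey; apply: AD; apply: EA.
  by rewrite lte_fin ltrDl.
Qed.

Lemma mod_lower_dim_ge0 A : (0 <= mod_lower_dim A)%E.
Proof.
apply: ereal_sup_ubound; exists set0; first exact: sub0set.
by rewrite /lower_dim asboolT.
Qed.

(** * Limits of selections along an ultrafilter *)

(** Move [y L] to a point [z L] of [K] within [mdist K L], which tends to 0. By compactness [z L]
    clusters along [U], and along an ultrafilter a cluster point is a limit. *)
Lemma ultra_selection_cvg (U : set_system (hyperspace T))
    (y : hyperspace T -> T) (K : hyperspace T) :
  UltraFilter U -> U --> K -> U [set L : hyperspace T | (L : set T) (y L)] ->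
  exists2 z, (K : set T) z & y L @[L --> U] --> z.
Proof.
move=> UU UK Uy; have /choice[z zP] (L : hyperspace T) : exists z,
    (K : set T) z /\ ((L : set T) (y L) -> mdist (y L) z <= mdist K L).
  have [KL LK] := hausdorff_dist_min K L; have [k Kk] := hyperspace_neq0 K.
  have [/LK[z Kz yz]|] := pselect ((L : set T) (y L)); first by exists z.
  by exists k.
have [|c [Kc cc]] := @hyperspace_compact _ _ K (z L @[L --> U]) _ _.
  exact: (filterE _ (fun L => (zP L).1)).
exists c => //; apply/metricType_numDomainType.cvgrPdist_lt => e e0.
have e20 : 0 < e / 2 by rewrite divr_gt0.
(* Otherwise the complement would belong to [U], against the clustering at [c]. *)
have Uc : \forall L \near U, mdist c (z L) < e / 2.
  have [//|Un] := in_ultra_setVsetC [set L | mdist c (z L) < e / 2] UU.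
  have := cc (~` [set x | mdist c x < e / 2]) (ball c (e / 2)) Un.
  rewrite ballEmdist => /(_ _)[|x []//].
  by have := nbhsx_ballx c _ e20; rewrite ballEmdist.
have UKe : \forall L \near U, mdist K L < e / 2.
  exact/(metricType_numDomainType.fcvgrPdist_lt K).1.
near=> L; rewrite (le_lt_trans (metric_triangle _ (z L) _))// [ltRHS]splitr.
apply: ltrD; first by near: L.
rewrite metric_sym (le_lt_trans ((zP L).2 _))//; first by near: L.
near: L; exact: UKe.
Unshelve. all: by end_near. Qed.

Lemma cvg_mdist (I : Type) (F : set_system I) (f g : I -> T) x y :
  Filter F -> f L @[L --> F] --> x -> g L @[L --> F] --> y ->
  mdist (f L) (g L) @[L --> F] --> mdist x y.
Proof.
move=> FF fx gy; apply/cvgrPdist_lt => e e0.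
have e20 : 0 < e / 2 by rewrite divr_gt0.
near=> L.
have fL : mdist x (f L) < e / 2.
  by near: L; exact: (metricType_numDomainType.cvgr_dist_lt fx e20).
have gL : mdist y (g L) < e / 2.
  by near: L; exact: (metricType_numDomainType.cvgr_dist_lt gy e20).
have h1 := metric_triangle x (f L) y.
have h2 := metric_triangle (f L) (g L) y.
have h3 := metric_triangle (f L) x (g L).
have h4 := metric_triangle x y (g L).
rewrite (metric_sym (f L) x) in h3; rewrite (metric_sym (g L) y) in h2.
by rewrite ltr_norml; apply/andP; split; lra.
Unshelve. all: by end_near. Qed.

(** Besides membership, [abundant] demands of points only non-strict inequalities between distances,
    which survive limits; the number [n.+1] is prescribed independently of the set. *)
Lemma closed_abundant e b : closed [set K : hyperspace T |
  exists2 E : set T, E `<=` (K : set T) & abundant e b E].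
Proof.
set S := (X in closed X) => K clK.
have [U [UU WU]] := ultraFilterLemma (within_nbhs_proper clK).
have UK : U --> K by move=> B KB; apply: WU; apply: filterS KB => x.
have US : U S by apply: WU; exact: withinT.
have [x0 Kx0] := hyperspace_neq0 K.
have /choice[E EP] (L : hyperspace T) : exists E, S L ->
    E `<=` (L : set T) /\ abundant e b E.
  have [[E EL abE]|nS] := pselect (S L); first by exists E.
  by exists set0.
have lim (y : hyperspace T -> T) : (forall L, S L -> E L (y L)) ->
    exists2 z, (K : set T) z & y L @[L --> U] --> z.
  move=> Ey; apply: (ultra_selection_cvg UU UK); apply: filterS US => L SL.
  by have [EL _] := EP _ SL; apply/EL/Ey.
(* Each limit point comes with a selection [y], around which separated families in the [E L] can be
   picked. *)
exists [set z | (K : set T) z /\ exists2 y : hyperspace T -> T,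
    (forall L, S L -> E L (y L)) & y L @[L --> U] --> z].
  by move=> z [].
have ge_lim (f g : hyperspace T -> T) x y r : f L @[L --> U] --> x ->
    g L @[L --> U] --> y -> (forall L, S L -> r <= mdist (f L) (g L)) ->
    r <= mdist x y.
  move=> fx gy fg.
  by apply: cvgr_to_ge (cvg_mdist _ fx gy) _; apply: filterS US.
split.
- have /choice[p pP] (L : hyperspace T) : exists p : T * T, S L ->
      [/\ E L p.1, E L p.2 & e <= mdist p.1 p.2].
    have [/EP[_ [[x [y xy]] _]]|] := pselect (S L); first by exists (x, y).
    by exists (x0, x0).
  have [|x Kx px] := lim (fun L => (p L).1); first by move=> L /pP[].
  have [|y Ky py] := lim (fun L => (p L).2); first by move=> L /pP[].
  exists x, y; split; last by apply: ge_lim px py _ => L /pP[].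
  + by split=> //; exists (fun L => (p L).1) => // L /pP[].
  + by split=> //; exists (fun L => (p L).2) => // L /pP[].
- move=> x r r' n [Kx [y Ey yx]] r0 rr' r'e ltn.
  (* For each index, the points picked around [y L] form a selection again, so their limit lies in
     the limit set. *)
  have /choice[p pP] (L : hyperspace T) : exists p : 'I_n.+1 -> T, S L ->
      (forall i, (E L `&` cball (y L) r') (p i)) /\
      (forall i j, i != j -> r / 2 <= mdist (p i) (p j)).
    have [SL|] := pselect (S L); last by exists (fun=> x0).
    have [_ [_ abE]] := EP _ SL.
    by have [p] := abE (y L) r r' n (Ey L SL) r0 rr' r'e ltn; exists p.
  have /choice[q qP] i : exists z, (K : set T) z /\ p L i @[L --> U] --> z.
    by have [|z] := lim (fun L => p L i); [move=> L /pP[/(_ i)[]]|exists z].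
  exists q; split=> [i|i j ij]; last first.
    by apply: ge_lim (qP i).2 (qP j).2 _ => L /pP[_]; apply.
  split; first split; first by case: (qP i).
    exists (fun L => p L i); last by case: (qP i).
    by move=> L /pP[/(_ i)[]].
  rewrite /cball/=; apply: cvgr_to_le (cvg_mdist _ yx (qP i).2) _.
  by apply: filterS US => L /pP[/(_ i)[]].
Qed.

End separation.

(** * Nonnegative functions with F_sigma superlevel sets *)

Section Fsigma_superlevel.
Set Implicit Arguments.
Unset Strict Implicit.
Unset Printing Implicit Defensive.
Local Open Scope classical_set_scope.
Local Open Scope ring_scope.
Context {R : realType}.

(** Intersect the neighbourhoods of [C] of size 1/(n+1). Interiors are taken because balls of a
    pseudometric type need not be open. *)
Lemma closed_Gdelta (Y : pseudoMetricType R) (C : set Y) : closed C -> Gdelta C.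
Proof.
move=> cC; exists (fun n => \bigcup_(c in C) (ball c n.+1%:R^-1)^°).
  by move=> n; apply: bigcup_open => c _; exact: open_interior.
apply/seteqP; split=> [c Cc n _|y Cy].
  by exists c => //; apply: nbhsx_ballx; rewrite invr_gt0.
apply: cC => B /nbhs_ballP[e /= e0 yB].
have [c Cc /interior_subset cy] := Cy (Num.truncn e^-1) I.
exists c; split=> //; apply: yB; apply: le_ball (ball_sym cy).
by rewrite -[leRHS]invrK lef_pV2 ?posrE ?invr_gt0// ltW// truncnS_gt.
Qed.

(** Closed sets are G_delta, which settles superlevel sets; a strict sublevel set is a countable
    union of weak ones, which are complements of F_sigma sets. *)
Lemma baire_class2_Fsigma (Y : pseudoMetricType R) (f : Y -> \bar R) :
  (forall y, 0 <= f y)%E ->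
  (forall a : R, 0 <= a -> Fsigma [set y | a%:E < f y]%E) -> baire_class2 f.
Proof.
move=> f0 fF; have le_Gdelta a : 0 <= a -> Gdelta [set y | f y <= a%:E]%E.
  move=> /fF[F cF FE]; exists (fun n => ~` F n).
    by move=> n; exact: closed_openC.
  rewrite -setC_bigcup -FE; apply/seteqP.
  by split=> y /=; rewrite leNgt => /negP.
move=> a a0; split.
  have [F cF FE] := fF a a0.
  by exists F => // n; exact: closed_Gdelta.
(* At level 0 the union used below would give the zero set of [f] instead of the empty set. *)
have [->|an0] := eqVneq a 0.
  exists (fun=> set0); first by move=> _; apply/closed_Gdelta/closed0.
  rewrite bigcup0//; apply/seteqP; split=> y //=.
  by rewrite ltNge f0.
have a1 : 0 < a by rewrite lt_neqAle eq_sym an0.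
(* The maximum keeps the levels nonnegative, where [le_Gdelta] applies. *)
exists (fun n => [set y | f y <= (Num.max 0 (a - n.+1%:R^-1))%:E]%E).
  by move=> n; apply: le_Gdelta; rewrite le_max lexx.
apply/seteqP; split=> y /=; last first.
  move=> [n _ /= /le_lt_trans]; apply; rewrite lte_fin gt_max a1 ltrBlDr ltrDl.
  by rewrite andTb invr_gt0.
have := f0 y; case fy : (f y) => [t| |]// _; rewrite lte_fin => ta.
exists (Num.truncn (a - t)^-1) => //=; rewrite fy lee_fin le_max lerBrDr -lerBrDl.
have at0 : 0 < a - t by rewrite subr_gt0.
apply/orP; right; rewrite -[leRHS]invrK lef_pV2 ?posrE ?invr_gt0//.
by rewrite ltW// truncnS_gt.
Qed.

(** The sets with Borel preimage form a sigma-algebra, so the generating open rays suffice. *)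
Lemma borel_measurable_Fsigma (Y : topologicalType) (f : Y -> \bar R) :
  (forall y, 0 <= f y)%E ->
  (forall a : R, 0 <= a -> Fsigma [set y | a%:E < f y]%E) -> borel_measurable f.
Proof.
move=> f0 fF B.
have -> : measurable B = <<s @ErealGenOInfty.G R >> B.
  exact: (congr1 (@^~ B) (ErealGenOInfty.measurableE R)).
move: B; apply: (@smallest_sub _ _ _ [set B | <<s @open Y >> (f @^-1` B)]).
  split=> /=.
  - by rewrite preimage_set0; exact: sigma_algebra0.
  - by move=> A mA; rewrite setTD preimage_setC -setTD; exact: sigma_algebraCD.
  - by move=> A mA; rewrite preimage_bigcup; exact: sigma_algebra_bigcup.
move=> _ [a ->] /=; have [a0|a0] := ltP a 0.
  have -> : f @^-1` `]a%:E, +oo[ = setT.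
    apply/seteqP; split=> y //= _; rewrite in_itv/= andbT.
    by rewrite (lt_le_trans _ (f0 y))// lte_fin.
  by apply: sub_sigma_algebra; exact: openT.
have [F cF FE] := fF a a0.
have -> : f @^-1` `]a%:E, +oo[ = \bigcup_n F n.
  by rewrite -FE; apply/seteqP; split=> y; rewrite /= in_itv/= andbT.
apply: sigma_algebra_bigcup => n; rewrite -[F n]setCK -setTD.
by apply: sigma_algebraCD; apply: sub_sigma_algebra; exact: closed_openC.
Qed.

Lemma Fsigma_mod_lower_dim_gt (T : metricType R) (a : R) : 0 <= a ->
  Fsigma [set K : hyperspace T | (a%:E < mod_lower_dim (K : set T))%E].
Proof.
move=> a0; exists (fun n => [set K : hyperspace T | exists2 E : set T,
    E `<=` (K : set T) & abundant n.+1%:R^-1 (a + n.+1%:R^-1) E]).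
  by move=> n; exact: closed_abundant.
apply/seteqP; split=> K /=.
  move=> /(mod_lower_dim_gt (@hyperspace_compact _ _ K) a0)[n [E [EK abE]]].
  by exists n => //; exists E.
move=> [n _ [E EK abE]]; apply/(mod_lower_dim_gt (@hyperspace_compact _ _ K) a0).
by exists n, E.
Qed.

End Fsigma_superlevel.

Local Open Scope ereal_scope.

Theorem theorem4p3 (R : realType) (X : metricType R) :
  let dim_ML (K : hyperspace X) : \bar R := mod_lower_dim (K : set X) in
  [/\ forall K : hyperspace X, 0 <= dim_ML K,
      borel_measurable dim_ML &
      baire_class2 dim_ML].
Proof.
move=> dim_ML; have dim_ML0 K : 0 <= dim_ML K by exact: mod_lower_dim_ge0.
split=> //.
- exact: borel_measurable_Fsigma dim_ML0 (@Fsigma_mod_lower_dim_gt R X).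
- exact: baire_class2_Fsigma dim_ML0 (@Fsigma_mod_lower_dim_gt R X).
Qed.
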